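(* The stable commutator length for $\operatorname{Aut}_\infty(F)$ vanishes identically, i.e. $\Vert g\Vert=0$ for every $g$ in the commutator subgroup of $\operatorname{Aut}_\infty(F)$.
   Context: Let $F_n$ be the free group of rank $n$. The canonical homomorphisms $F_n\rightarrow F_n\star\mathbb{Z}=F_{n+1}$ induce injective homomorphisms $\operatorname{Aut}(F_n)\rightarrow\operatorname{Aut}(F_{n+1})$, extending an automorphism of $F_n$ by the identity on the free factor $\mathbb{Z}$. Define $\operatorname{Aut}_\infty(F)=\bigcup_n\operatorname{Aut}(F_n)$. For a group $\Gamma$ and $g\in[\Gamma,\Gamma]$, the commutator length $c(g)$ is the minimal number of factors needed to write $g$ as a product of single commutators of elements of $\Gamma$. The stable commutator length of $g$ is $\Vert g\Vert=\lim_{n\rightarrow\infty}\frac{c(g^n)}{n}$. *)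

(* Defs.v *)
From HB Require Import structures.
From mathcomp Require Import all_boot all_order all_algebra.
From mathcomp Require Import all_classical all_reals all_analysis.
Set Implicit Arguments.
Unset Strict Implicit.
Unset Printing Implicit Defensive.
Import Order.TTheory GRing.Theory Num.Theory.
Import numFieldNormedType.Exports.
Local Open Scope group_scope.

Section FreeGroup.
Variable T : choiceType.

(* The letter (x, false) stands for the generator x, and (x, true) for its
   formal inverse. *)
Definition letter : Type := (T * bool)%type.
HB.instance Definition _ := Choice.on letter.

Implicit Types (a b : letter) (u v w : seq letter).

Definition linv a : letter := (a.1, ~~ a.2).

Definition reduced w := sorted (fun a b => b != linv a) w.

Definition push a w :=
  if w is b :: w' then if b == linv a then w' else a :: w else [:: a].

Definition reduce w := foldr push [::] w.

Record freegroup := FreeGroup { fgword :> seq letter; _ : reduced fgword }.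
HB.instance Definition _ := [isSub for fgword].
HB.instance Definition _ := [Choice of freegroup by <:].

Lemma linvK : involutive linv.
Proof. by case=> x b; rewrite /linv /= negbK. Qed.

Lemma reduced_push a w : reduced w -> reduced (push a w).
Proof.
case: w => [|b w] //= pw; case: eqP => [_|/eqP nab] /=; last by rewrite nab.
by case: w pw => //= c w /andP[].
Qed.

Lemma push_red a w : reduced (a :: w) -> push a w = a :: w.
Proof. by case: w => [|b w] //= /andP[/negbTE ->]. Qed.

Lemma pushK a w : reduced w -> push (linv a) (push a w) = w.
Proof.
case: w => [|b w] /=; first by rewrite linvK eqxx.
case: (b =P linv a) => [-> rw|_ _] /=; last by rewrite linvK eqxx.
by rewrite push_red.
Qed.

Lemma reduced_foldr u v : reduced v -> reduced (foldr push v u).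
Proof. by move=> rv; elim: u => //= a u; apply: reduced_push. Qed.

Lemma reduced_reduce w : reduced (reduce w).
Proof. exact: reduced_foldr. Qed.

Lemma reduce_id w : reduced w -> reduce w = w.
Proof.
elim: w => //= a w IH rw; rewrite IH ?push_red //.
by case: w rw {IH} => //= b w /andP[].
Qed.

Lemma foldr_reduce u v : reduced v -> foldr push v (reduce u) = foldr push v u.
Proof.
move=> rv; elim: u => //= a u <-; have := reduced_reduce u.
case: (reduce u) => [|b w] //= rw.
case: (b =P linv a) => [->|] //=.
by rewrite -{1}[a]linvK pushK // reduced_foldr.
Qed.

Lemma foldr_push_cat u v w :
  reduced w -> foldr push w (reduce (u ++ v)) = foldr push (foldr push w v) u.
Proof. by move=> rw; rewrite foldr_reduce // foldr_cat. Qed.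

Definition winv w := rev (map linv w).

Lemma reduced_winv w : reduced w -> reduced (winv w).
Proof.
rewrite /winv /reduced rev_sorted sorted_map => rw; apply: sub_sorted rw.
by move=> a b /=; apply: contraNN => /eqP ->; rewrite linvK.
Qed.

Definition fgone := @FreeGroup [::] isT.
Definition fgmul (x y : freegroup) := FreeGroup (reduced_reduce (x ++ y)).
Definition fginv (x : freegroup) := FreeGroup (reduced_winv (valP x)).

Lemma fgmulE (x y : freegroup) : fgmul x y = foldr push y x :> seq letter.
Proof.
by rewrite /= /reduce foldr_cat -/(reduce y) (reduce_id (valP y)).
Qed.

Fact fgmulA : associative fgmul.
Proof.
move=> x y z; apply: val_inj.
rewrite [LHS]fgmulE [RHS]fgmulE (fgmulE y z) foldr_push_cat //.
exact: valP z.
Qed.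

Fact fgmul1 : left_id fgone fgmul.
Proof. by move=> x; apply: val_inj; rewrite /= (reduce_id (valP x)). Qed.

Fact fg1mul : right_id fgone fgmul.
Proof. by move=> x; apply: val_inj; rewrite /= cats0 (reduce_id (valP x)). Qed.

Lemma foldr_winv w v : reduced v -> foldr push (foldr push v w) (winv w) = v.
Proof.
move=> rv; elim: w => //= a w IH; rewrite /winv /= rev_cons foldr_rcons.
by rewrite pushK ?reduced_foldr.
Qed.

Lemma winvK : involutive winv.
Proof. by move=> w; rewrite /winv map_rev revK mapK //; apply: linvK. Qed.

Fact fgmulV : left_inverse fgone fginv fgmul.
Proof.
move=> x; apply: val_inj; rewrite /= /reduce foldr_cat.
by rewrite foldr_winv.
Qed.

Fact fgVmul : right_inverse fgone fginv fgmul.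
Proof.
move=> x; apply: val_inj; rewrite /= /reduce foldr_cat.
by have := @foldr_winv (winv x) [::] isT; rewrite winvK.
Qed.

HB.instance Definition _ :=
  isGroup.Build freegroup fgmulA fgmul1 fg1mul fgmulV fgVmul.

Definition fggen (x : T) : freegroup := @FreeGroup [:: (x, false)] isT.

Section Lift.
Variables (G : groupType) (f : T -> G).

Definition letter_val a : G := if a.2 then (f a.1)^-1 else f a.1.

Definition fglift (x : freegroup) : G := \prod_(a <- x) letter_val a.

Lemma letter_valV a : letter_val (linv a) = (letter_val a)^-1.
Proof. by case: a => x [] /=; rewrite /letter_val /= ?invgK. Qed.

Lemma prod_push a w :
  \prod_(b <- push a w) letter_val b = letter_val a * \prod_(b <- w) letter_val b.
Proof.
case: w => [|b w] /=; first by rewrite big_cons.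
case: eqP => [->|_]; rewrite !big_cons //.
by rewrite letter_valV mulVKg.
Qed.

Lemma fgliftM : {morph fglift : x y / x * y}.
Proof.
move=> x y; rewrite /fglift [X in bigop _ X _]fgmulE.
elim: (fgword x) => [|a w IH] /=; first by rewrite big_nil mul1g.
by rewrite prod_push IH big_cons mulgA.
Qed.

HB.instance Definition _ := isMultiplicative.Build freegroup G fglift fgliftM.

Lemma fglift_gen x : fglift (fggen x) = f x.
Proof. by rewrite /fglift /= big_seq1. Qed.

End Lift.

Lemma multiplicative1 (G H : groupType) (h : {multiplicative G -> H}) : h 1 = 1.
Proof. by apply: (mulgI (h 1)); rewrite -gmulfM !mulg1. Qed.

Lemma multiplicativeV (G H : groupType) (h : {multiplicative G -> H}) :
  {morph h : x / x^-1}.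
Proof.
by move=> x; apply/esym/mulg1_eq; rewrite -gmulfM mulgV multiplicative1.
Qed.

Lemma freegroup_ext (G : groupType) (h k : {multiplicative freegroup -> G}) :
  (forall x, h (fggen x) = k (fggen x)) -> forall x, h x = k x.
Proof.
move=> hk [w]; elim: w => [|a w IH] rw.
  have -> : FreeGroup rw = 1 by apply: val_inj.
  by rewrite !multiplicative1.
have rw' : reduced w by case: w rw {IH} => //= b w /andP[].
have ra : reduced [:: a] by [].
have -> : FreeGroup rw = FreeGroup ra * FreeGroup rw'.
  by apply: val_inj; rewrite [RHS]fgmulE /= push_red.
rewrite !gmulfM IH; congr (_ * _); case: a {rw} ra => x [] ra; last first.
  by have -> : FreeGroup ra = fggen x by apply: val_inj.
have -> : FreeGroup ra = (fggen x)^-1 by apply: val_inj.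
by rewrite !multiplicativeV hk.
Qed.

End FreeGroup.

Section Automorphisms.
Variable G : groupType.

Record aut := Aut {
  aut_fun :> G -> G;
  aut_bwd : G -> G;
  autM : {morph aut_fun : x y / x * y};
  autK : cancel aut_fun aut_bwd;
  autVK : cancel aut_bwd aut_fun }.

HB.instance Definition _ := gen_eqMixin aut.
HB.instance Definition _ := gen_choiceMixin aut.
HB.instance Definition _ (f : aut) := isMultiplicative.Build G G f (@autM f).

Lemma aut_ext (f g : aut) : f =1 g -> f = g.
Proof.
case: f g => [f f' fM fK f'K] [g g' gM gK g'K] /= fg.
have efg : f = g by apply/funext.
have efg' : f' = g' by apply/funext => x; apply: (canLR fK); rewrite efg g'K.
by subst; congr Aut; apply: Prop_irrelevance.
Qed.

Definition aut_one : aut :=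
  @Aut idfun idfun (fun _ _ => erefl) (fun _ => erefl) (fun _ => erefl).

Fact aut_mulM (f g : aut) : {morph f \o g : x y / x * y}.
Proof. by move=> x y /=; rewrite !autM. Qed.

Definition aut_mul (f g : aut) : aut :=
  Aut (@aut_mulM f g) (can_comp (@autK f) (@autK g))
    (can_comp (@autVK g) (@autVK f)).

Definition aut_inv (f : aut) : aut :=
  Aut (can2_gmulfM (@autK f) (@autVK f)) (@autVK f) (@autK f).

Fact aut_mulA : associative aut_mul.
Proof. by move=> f g h; apply: aut_ext. Qed.
Fact aut_mul1g : left_id aut_one aut_mul.
Proof. by move=> f; apply: aut_ext. Qed.
Fact aut_mulg1 : right_id aut_one aut_mul.
Proof. by move=> f; apply: aut_ext. Qed.
Fact aut_mulVg : left_inverse aut_one aut_inv aut_mul.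
Proof. by move=> f; apply: aut_ext => x; apply: autK. Qed.
Fact aut_mulgV : right_inverse aut_one aut_inv aut_mul.
Proof. by move=> f; apply: aut_ext => x; apply: autVK. Qed.

HB.instance Definition _ :=
  isGroup.Build aut aut_mulA aut_mul1g aut_mulg1 aut_mulVg aut_mulgV.

Lemma aut_mulE (f g : aut) x : (f * g) x = f (g x). Proof. by []. Qed.

End Automorphisms.

Section DirectLimit.
Variables (G : nat -> groupType) (phi : forall n, {multiplicative G n -> G n.+1}).

(* For m <= n, dltrans m n is the composite phi_(n-1) \o ... \o phi_m;
   its value is irrelevant when n < m. *)
Fixpoint dltrans m n (x : G m) : G n :=
  match m =P n with
  | ReflectT e => ecast k (G k) e x
  | ReflectF _ => match n with 0 => 1 | n'.+1 => phi n' (dltrans n' x) end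
  end.

Lemma dltrans_id m (x : G m) : dltrans m x = x.
Proof.
by case: m x => [|m] x /=; case: eqP => // e; rewrite eq_axiomK.
Qed.

Lemma dltransS m n (x : G m) :
  m <= n -> dltrans n.+1 x = phi n (dltrans n x).
Proof. by move=> le_mn /=; case: eqP => // e; exfalso; move: le_mn; rewrite e ltnn. Qed.

Lemma dltrans_trans m n p (x : G m) :
  m <= n -> n <= p -> dltrans p (dltrans n x) = dltrans p x.
Proof.
move=> le_mn; elim: p => [|p IH].
  by rewrite leqn0 => /eqP n0; subst n; rewrite dltrans_id.
rewrite leq_eqVlt => /predU1P[->|]; first by rewrite dltrans_id.
by rewrite ltnS => le_np; rewrite !dltransS ?IH //; apply: leq_trans le_np.
Qed.

Lemma dltransM m n : m <= n -> {morph @dltrans m n : x y / x * y}.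
Proof.
move=> + x y; elim: n => [|n IH].
  by rewrite leqn0 => /eqP m0; subst m; rewrite !dltrans_id.
rewrite leq_eqVlt => /predU1P[e|]; first by subst m; rewrite !dltrans_id.
by rewrite ltnS => le_mn; rewrite !dltransS // IH // gmulfM.
Qed.

Definition dlrep : Type := {n : nat & G n}.
HB.instance Definition _ := Choice.on dlrep.

Definition dleq (p q : dlrep) : bool :=
  `[< exists N, [/\ tag p <= N, tag q <= N &
        dltrans N (tagged p) = dltrans N (tagged q)] >].

Lemma dleq_refl : reflexive dleq.
Proof. by move=> p; apply/asboolP; exists (tag p). Qed.

Lemma dleq_sym : symmetric dleq.
Proof.
by move=> p q; apply/asboolP/asboolP => -[N [? ? E]]; exists N; split.
Qed.

Lemma dleq_trans : transitive dleq.
Proof.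
move=> q p r /asboolP[M [pM qM E]] /asboolP[N [qN rN E']].
have lM := leq_maxl M N; have lN := leq_maxr M N.
apply/asboolP; exists (maxn M N); split; [exact: leq_trans lM|exact: leq_trans lN|].
rewrite -(dltrans_trans _ pM lM) E (dltrans_trans _ qM lM).
by rewrite -(dltrans_trans _ qN lN) E' (dltrans_trans _ rN lN).
Qed.

Canonical dl_equiv := EquivRel dleq dleq_refl dleq_sym dleq_trans.

Definition dirlim : Type := {eq_quot dl_equiv}%qT.
HB.instance Definition _ := Choice.on dirlim.

Definition dlpi n (x : G n) : dirlim := \pi_({eq_quot dl_equiv})%qT (Tagged G x).

Lemma dlpi_eq m n (x : G m) (y : G n) : dlpi x = dlpi y <->
  exists N, [/\ m <= N, n <= N & dltrans N x = dltrans N y].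
Proof.
split=> H; last by apply/eqmodP; apply/asboolP.
exact/(@asboolP _)/(@eqmodP _ dl_equiv (Tagged G x) (Tagged G y)).
Qed.

Lemma dlpi_trans m n (x : G m) : m <= n -> dlpi (dltrans n x) = dlpi x.
Proof.
by move=> le_mn; apply/dlpi_eq; exists n; split=> //; rewrite dltrans_id.
Qed.

Lemma dlpi_phi n (x : G n) : dlpi (phi n x) = dlpi x.
Proof. by rewrite -(dlpi_trans x (leqnSn n)) dltransS // dltrans_id. Qed.

Lemma dlpi_surj (p : dirlim) : exists n (x : G n), p = dlpi x.
Proof.
by elim/quotW: p => -[n x]; exists n, x.
Qed.

Lemma dlpi_inj n : (forall k, injective (phi k)) -> injective (@dlpi n).
Proof.
move=> phiI x y /dlpi_eq[N [le_nN _]]; elim: N le_nN => [|N IH].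
  by rewrite leqn0 => /eqP n0; subst n; rewrite !dltrans_id.
rewrite leq_eqVlt => /predU1P[e|]; first by subst n; rewrite !dltrans_id.
by rewrite ltnS => le_nN; rewrite !dltransS // => /phiI/IH; apply.
Qed.

Definition dlone : dirlim := dlpi (1 : G 0).

Definition dlmul (p q : dirlim) : dirlim :=
  let x := repr p in let y := repr q in
  let N := maxn (tag x) (tag y) in
  dlpi (dltrans N (tagged x) * dltrans N (tagged y)).

Definition dlinv (p : dirlim) : dirlim := dlpi (tagged (repr p))^-1.

Lemma dlpi_repr (p : dirlim) : dlpi (tagged (repr p)) = p.
Proof. by rewrite -[RHS]reprK /dlpi; case: (repr p). Qed.

Lemma dlpiM n : {morph @dlpi n : x y / x * y >-> dlmul x y}.
Proof.
move=> x y; rewrite /dlmul.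
set p := repr _; set q := repr _; set k := maxn _ _.
have /dlpi_eq[N [pN nN Ex]] := dlpi_repr (dlpi x).
have /dlpi_eq[M [qM nM Ey]] := dlpi_repr (dlpi y).
have pk : tag p <= k := leq_maxl _ _; have qk : tag q <= k := leq_maxr _ _.
pose L := (k + (N + M))%N.
have kL : k <= L by apply: leq_addr.
have NL : N <= L by rewrite /L addnCA leq_addr.
have ML : M <= L by rewrite /L addnA leq_addl.
have nL : n <= L by apply: leq_trans NL.
apply/dlpi_eq; exists L; split=> //; rewrite !dltransM //.
rewrite !(dltrans_trans _ _ kL) //; congr (_ * _).
  by rewrite -(dltrans_trans _ nN NL) -Ex dltrans_trans.
by rewrite -(dltrans_trans _ nM ML) -Ey dltrans_trans.
Qed.

Lemma dltrans1 m n : m <= n -> dltrans n (1 : G m) = 1.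
Proof.
by move=> h; apply: (mulgI (dltrans n (1 : G m))); rewrite -dltransM // !mulg1.
Qed.

Lemma dltransV m n (x : G m) : m <= n -> dltrans n x^-1 = (dltrans n x)^-1.
Proof.
by move=> h; apply/esym/mulg1_eq; rewrite -dltransM // mulgV dltrans1.
Qed.

Lemma dlpi1 n : dlpi (1 : G n) = dlone.
Proof. by apply/dlpi_eq; exists n; split=> //; rewrite !dltrans1. Qed.

Lemma dlpiV n : {morph @dlpi n : x / x^-1 >-> dlinv x}.
Proof.
move=> x; rewrite /dlinv.
have /dlpi_eq[N [pN nN Ex]] := dlpi_repr (dlpi x).
by apply/dlpi_eq; exists N; split=> //; rewrite !dltransV // Ex.
Qed.

Lemma dlpi_surj3 (p q r : dirlim) :
  exists n (x y z : G n), [/\ p = dlpi x, q = dlpi y & r = dlpi z].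
Proof.
have [a [x ->]] := dlpi_surj p; have [b [y ->]] := dlpi_surj q.
have [c [z ->]] := dlpi_surj r.
exists (a + (b + c))%N, (dltrans _ x), (dltrans _ y), (dltrans _ z).
by rewrite !dlpi_trans // ?leq_addr // addnC -addnA ?leq_addr // addnCA leq_addr.
Qed.

Fact dlmulA : associative dlmul.
Proof.
by move=> p q r; have [n [x [y [z [-> -> ->]]]]] := dlpi_surj3 p q r;
  rewrite -!dlpiM mulgA.
Qed.
Fact dlmul1g : left_id dlone dlmul.
Proof.
by move=> p; have [n [x ->]] := dlpi_surj p; rewrite -(dlpi1 n) -dlpiM mul1g.
Qed.
Fact dlmulg1 : right_id dlone dlmul.
Proof.
by move=> p; have [n [x ->]] := dlpi_surj p; rewrite -(dlpi1 n) -dlpiM mulg1.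
Qed.
Fact dlmulVg : left_inverse dlone dlinv dlmul.
Proof.
by move=> p; have [n [x ->]] := dlpi_surj p; rewrite -dlpiV -dlpiM mulVg dlpi1.
Qed.
Fact dlmulgV : right_inverse dlone dlinv dlmul.
Proof.
by move=> p; have [n [x ->]] := dlpi_surj p; rewrite -dlpiV -dlpiM mulgV dlpi1.
Qed.

HB.instance Definition _ :=
  isGroup.Build dirlim dlmulA dlmul1g dlmulg1 dlmulVg dlmulgV.
HB.instance Definition _ n :=
  isMultiplicative.Build (G n) dirlim (@dlpi n) (@dlpiM n).

End DirectLimit.

Definition F (n : nat) : groupType := freegroup 'I_n.

Section Stabilization.
Variable n : nat.

(* The canonical map F_n -> F_n * Z = F_{n+1}; the free factor Z is generated
   by the last generator, fggen ord_max. *)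
Definition F_incl : F n -> F n.+1 :=
  fglift (fun i : 'I_n => fggen (widen_ord (leqnSn n) i) : F n.+1).
HB.instance Definition _ := Multiplicative.on F_incl.

(* The endomorphism of F_{n+1} that is F_incl \o h on the generators of F_n
   and fixes the last generator. *)
Definition stab_end (h : F n -> F n) : F n.+1 -> F n.+1 :=
  fglift (fun i : 'I_n.+1 =>
    if unlift ord_max i is Some j then F_incl (h (fggen j)) else fggen i).
HB.instance Definition _ h := Multiplicative.on (stab_end h).

Lemma F_incl_gen (i : 'I_n) :
  F_incl (fggen i) = fggen (lift ord_max i).
Proof.
rewrite /F_incl fglift_gen; congr fggen; apply: val_inj.
by rewrite /= /bump leqNgt ltn_ord.
Qed.

Lemma stab_end_incl (h : {multiplicative F n -> F n}) x :
  stab_end h (F_incl x) = F_incl (h x).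
Proof.
pose k1 : {multiplicative F n -> F n.+1} := stab_end h \o F_incl.
pose k2 : {multiplicative F n -> F n.+1} := F_incl \o h.
apply: (@freegroup_ext _ _ k1 k2) => i /=.
by rewrite F_incl_gen /stab_end fglift_gen liftK.
Qed.

Lemma stab_end_last (h : F n -> F n) :
  stab_end h (fggen ord_max) = fggen ord_max.
Proof. by rewrite /stab_end fglift_gen unlift_none. Qed.

Lemma F_ext (h k : {multiplicative F n.+1 -> F n.+1}) :
  (forall x, h (F_incl x) = k (F_incl x)) ->
  h (fggen ord_max) = k (fggen ord_max) -> h =1 k.
Proof.
move=> hk hk_last; apply: freegroup_ext => i.
by case: (unliftP ord_max i) => [j|] -> //; rewrite -F_incl_gen hk.
Qed.

Lemma stab_end_comp (h k : {multiplicative F n -> F n}) :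
  stab_end h \o stab_end k =1 stab_end (h \o k).
Proof.
by apply: F_ext => [x|] /=; rewrite ?stab_end_incl ?stab_end_last.
Qed.

Lemma stab_endK (h k : {multiplicative F n -> F n}) :
  cancel h k -> cancel (stab_end h) (stab_end k).
Proof.
move=> hK x; rewrite -[LHS]/((stab_end k \o stab_end h) x) stab_end_comp.
apply: (@F_ext (stab_end (k \o h)) idfun) => [y|] /=.
  by rewrite stab_end_incl /= hK.
by rewrite stab_end_last.
Qed.

Definition stab (f : aut (F n)) : aut (F n.+1) :=
  Aut (@fgliftM _ _ _ : {morph stab_end f : x y / x * y})
    (@stab_endK f (f^-1 : aut (F n)) (@autK _ f))
    (@stab_endK (f^-1 : aut (F n)) f (@autVK _ f)).

Fact stabM : {morph stab : f g / f * g}.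
Proof. by move=> f g; apply: aut_ext => x /=; rewrite -stab_end_comp. Qed.
HB.instance Definition _ :=
  isMultiplicative.Build (aut (F n)) (aut (F n.+1)) stab stabM.

Lemma stab_incl f x : stab f (F_incl x) = F_incl (f x).
Proof. exact: stab_end_incl. Qed.

Lemma stab_last f : stab f (fggen ord_max) = fggen ord_max.
Proof. exact: stab_end_last. Qed.

Lemma F_incl_inj : injective F_incl.
Proof.
pose r : {multiplicative F n.+1 -> F n} :=
  fglift (fun i : 'I_n.+1 =>
    if unlift ord_max i is Some j then fggen j : F n else 1).
apply: (@can_inj _ _ _ r).
apply: (@freegroup_ext _ _ (r \o F_incl) idfun) => i /=.
by rewrite F_incl_gen /r /= fglift_gen liftK.
Qed.

Lemma stab_inj : injective stab.
Proof.
move=> f g fg; apply: aut_ext => x; apply: F_incl_inj.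
by rewrite -!stab_incl fg.
Qed.

End Stabilization.

(* The union of the Aut(F_n) is their direct limit along the (injective)
   stabilization maps. *)
Definition Aut_infty : groupType := dirlim
  (fun n => [the {multiplicative aut (F n) -> aut (F n.+1)} of @stab n]).

Definition Aut_incl n (f : aut (F n)) : Aut_infty :=
  dlpi (fun n => [the {multiplicative aut (F n) -> aut (F n.+1)} of @stab n]) f.

Lemma Aut_inclM n : {morph @Aut_incl n : f g / f * g}.
Proof. exact: dlpiM. Qed.
HB.instance Definition _ n :=
  isMultiplicative.Build (aut (F n)) Aut_infty (@Aut_incl n) (@Aut_inclM n).

Lemma Aut_incl_inj n : injective (@Aut_incl n).
Proof. by apply: dlpi_inj => k; apply: stab_inj. Qed.

Lemma Aut_incl_stab n (f : aut (F n)) : Aut_incl (stab f) = Aut_incl f.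
Proof. exact: dlpi_phi. Qed.

Lemma Aut_infty_union (g : Aut_infty) : exists n (f : aut (F n)), g = Aut_incl f.
Proof. exact: dlpi_surj. Qed.

Section CommutatorLength.
Variable G : groupType.
Implicit Type g : G.

Definition commutator_subgroup g : Prop :=
  forall S : {pred G},
    group_closed S -> (forall x y, [~ x, y] \in S) -> g \in S.

Definition commutator_product k g : Prop :=
  exists a b : 'I_k -> G, g = \prod_(i < k) [~ a i, b i].

(* The value 0 outside the commutator subgroup is a dummy. *)
Definition commutator_length g : nat :=
  if pselect (exists k, `[< commutator_product k g >]) is left ex_k
  then ex_minn ex_k else 0.

Lemma commutator_productM k l g h : commutator_product k g ->
  commutator_product l h -> commutator_product (k + l) (g * h).
Proof.
move=> [a [b ->]] [c [d ->]].
exists (fun i : 'I_(k + l) => match fintype.split i with inl j => a j | inr j => c j end),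
       (fun i : 'I_(k + l) => match fintype.split i with inl j => b j | inr j => d j end).
rewrite big_split_ord /=; congr (_ * _); apply: eq_bigr => i _.
  by rewrite (unsplitK (inl i)).
by rewrite (unsplitK (inr i)).
Qed.

Lemma commutator_product0 : commutator_product 0 1.
Proof. by exists (fun=> 1), (fun=> 1); rewrite big_ord0. Qed.

Lemma commutator_product1 x y : commutator_product 1 [~ x, y].
Proof. by exists (fun=> x), (fun=> y); rewrite big_ord1. Qed.

Lemma commutator_productV k g : commutator_product k g ->
  commutator_product k g^-1.
Proof.
elim: k g => [|k IH] g [a [b ->]].
  by rewrite big_ord0 invg1; apply: commutator_product0.
rewrite big_ord_recl invgM invgR; set h := \prod_(i < k) _.
have : commutator_product k h^-1 by apply: IH; eexists _, _.
by move=> /commutator_productM/(_ (commutator_product1 _ _)); rewrite addn1.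
Qed.

Lemma commutator_subgroupP g :
  commutator_subgroup g <-> exists k, commutator_product k g.
Proof.
split=> [|[k [a [b ->]]] S S_gr S_comm]; last first.
  elim/big_ind: _ => [||i _ //]; first exact: S_gr.1.
  exact: group_closedM.
pose S := [pred h | `[< exists k, commutator_product k h >]].
move=> /(_ S) gS; apply/asboolP; apply: gS => [|x y]; last first.
  by apply/asboolP; exists 1%N; apply: commutator_product1.
split; first by apply/asboolP; exists 0; apply: commutator_product0.
move=> x y /asboolP[k xk] /asboolP[l /commutator_productV yl].
by apply/asboolP; exists (k + l)%N; apply: commutator_productM.
Qed.

Lemma commutator_lengthP g : commutator_subgroup g ->
  commutator_product (commutator_length g) g /\
  forall k, commutator_product k g -> commutator_length g <= k.
Proof.
move=> /commutator_subgroupP[k gk]; rewrite /commutator_length.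
case: pselect => [ex_k|[]]; last by exists k; apply/asboolP.
case: ex_minnP => m /asboolP gm m_min; split=> // l gl.
by apply: m_min; apply/asboolP.
Qed.

End CommutatorLength.

Local Open Scope ring_scope.
Local Open Scope classical_set_scope.

Definition scl_seq (R : realType) (G : groupType) (g : G) : R^nat :=
  fun n => (commutator_length (g ^+ n)%g)%:R / n%:R.

Definition stable_commutator_length (R : realType) (G : groupType) (g : G) : R :=
  limn (scl_seq R g).

(* Main.v *)
Require Import Defs.
From HB Require Import structures.
From mathcomp Require Import all_boot all_order all_algebra.
From mathcomp Require Import all_classical all_reals all_analysis.
Import numFieldNormedType.Exports.
Import Order.TTheory GRing.Theory Num.Theory.
Local Open Scope ring_scope.
Local Open Scope classical_set_scope.

(** The commutator lengths of all the powers of [g] are bounded by one constant,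
    so that [c(g^n) / n] tends to zero.

    Write [g] as a product of [k] commutators of elements of some [Aut(F_n)].
    Given [N], let [t] be an automorphism of a free group of large rank that
    permutes the generators cyclically by [n] places.  The conjugates of
    [Aut(F_n)] by [t], ..., [t^N] act on blocks of generators disjoint from the
    first [n] ones, so they commute with [Aut(F_n)]
    ([shifts_commute_with_Aut]).  Consequently the product
    [Q = g * g^t * ... * g^(t^N)] is the image of [g] under a homomorphism
    defined on [Aut(F_n)] ([orbit_prodM]), and hence is again a product of [k]
    commutators.  On the other hand [Q] becomes [g^(N+1)] if its factors are
    replaced by their conjugates, and the error is a single commutator with [t]:
    [g^(N+1) = Q * [X^-1, t]], where
    [X = g^N * (g^(N-1))^t * ... * g^(t^(N-1))] ([expg_orbit_prod]).
    Therefore [c(g^(N+1)) <= k + 1] for every [N]. *)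

(** * Powers of an element with commuting conjugates *)

Section CommutingConjugates.
Local Open Scope group_scope.
Context {G : groupType}.
Implicit Types (g h t : G) (m : nat).

Definition orbit_prod t m g : G := \prod_(i < m) g ^ (t ^+ i).

Lemma orbit_prodS t m g : orbit_prod t m.+1 g = g * orbit_prod t m g ^ t.
Proof.
rewrite /orbit_prod big_ord_recl /= expg0 conjg1 conjg_prod; congr (_ * _).
by apply: eq_bigr => i _; rewrite -conjgM -expgSr.
Qed.

Lemma commute_orbit_prodJ t m g h :
    (forall d, (d < m)%N -> commute g (h ^ (t ^+ d.+1))) ->
  commute g (orbit_prod t m h ^ t).
Proof.
move=> gh; rewrite /orbit_prod conjg_prod; apply: commute_prod => i _.
by rewrite -conjgM -expgSr; apply: gh.
Qed.

(** In [X_m = g^m * (g^(m-1))^t * ... * g^(t^(m-1))] one has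
    [X_(m+1) = g^(m+1) * X_m^t], and, as [g] commutes with its conjugates by
    powers of [t], also [X_(m+1) = orbit_prod t m.+1 g * X_m].  Comparing the
    two exhibits [g^(m+1)] up to the commutator [X_m * (X_m^-1)^t]. *)
Lemma expg_orbit_prod t m g :
    (forall d, (d < m)%N -> commute g (g ^ (t ^+ d.+1))) ->
  exists x, g ^+ m.+1 = orbit_prod t m.+1 g * [~ x, t].
Proof.
move=> gC.
suff [x xE] : exists x, orbit_prod t m.+1 g * x = g ^+ m.+1 * x ^ t.
  by exists x^-1; rewrite commgEl invgK conjVg mulgA xE mulgK.
elim: m gC => [|m IHm] gC.
  by exists 1; rewrite orbit_prodS /orbit_prod big_ord0 !conj1g !mulg1.
have [d /ltnW ltd|x xE] := IHm; first exact: gC.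
exists (g ^+ m.+1 * x ^ t).
have gQ : commute (g ^+ m.+1) (orbit_prod t m.+1 g ^ t).
  by apply/commute_sym/commuteX/commute_sym/commute_orbit_prodJ.
rewrite [in LHS]orbit_prodS -{2}xE conjMg (expgS g m.+1).
set q := _ ^ t in gQ *; set y := x ^ t; set p := g ^+ m.+1 in gQ *.
by rewrite -mulgA (mulgA q) -gQ !mulgA.
Qed.

End CommutingConjugates.

Section CommutatorProducts.
Local Open Scope group_scope.
Context {H G : groupType}.
Implicit Type f : {multiplicative H -> G}.

Lemma multiplicativeX f n : {morph f : x / x ^+ n}.
Proof.
by move=> x; elim: n => [|n IHn]; rewrite ?multiplicative1 // !expgS gmulfM IHn.
Qed.

Lemma multiplicativeJ f : {morph f : x y / x ^ y}.
Proof. by move=> x y; rewrite !conjgE !gmulfM multiplicativeV. Qed.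

Lemma multiplicativeR f : {morph f : x y / [~ x, y]}.
Proof.
by move=> x y; rewrite !commgEl gmulfM multiplicativeV multiplicativeJ.
Qed.

Lemma commutator_product_morph (f : H -> G) k x :
    {morph f : x y / x * y} ->
  commutator_product k x -> commutator_product k (f x).
Proof.
move=> fM [a [b ->]].
pose fm : {multiplicative H -> G} :=
  HB.pack f (isMultiplicative.Build H G f fM).
exists (f \o a), (f \o b).
rewrite (big_morph f fM (multiplicative1 fm)).
by apply: eq_bigr => i _; apply: (multiplicativeR fm).
Qed.

(** The images of [f] conjugated by distinct powers of [t] commute with each
    other, since it suffices to compare them after conjugating the lower power
    away; the factors of the product can therefore be multiplied one by one. *)
Lemma orbit_prodM (f : {multiplicative H -> G}) t m :
    (forall x y d, (d < m)%N -> commute (f x) (f y ^ (t ^+ d.+1))) ->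
  {morph (fun x => orbit_prod t m.+1 (f x)) : x y / x * y}.
Proof.
elim: m => [|m IHm] fC x y /=.
  by rewrite !orbit_prodS /orbit_prod !big_ord0 !conj1g !mulg1 gmulfM.
rewrite !(orbit_prodS _ m.+1) IHm => [|u v d /ltnW]; last exact: fC.
have : commute (f y) (orbit_prod t m.+1 (f x) ^ t).
  by apply: commute_orbit_prodJ => d; apply: fC.
rewrite conjMg gmulfM; set p := _ ^ t; set q := _ ^ t => yp.
by rewrite -[RHS]mulgA (mulgA p (f y)) -yp !mulgA.
Qed.

(** The bound [k.+1] does not depend on the exponent: the orbit product of
    [f x] costs as many commutators as [x], and [expg_orbit_prod] adds one. *)
Lemma commutator_product_expg (f : {multiplicative H -> G}) t k m x :
    (forall x y d, (d < m)%N -> commute (f x) (f y ^ (t ^+ d.+1))) ->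
  commutator_product k x -> commutator_product k.+1 (f x ^+ m.+1).
Proof.
move=> fC xk; have [d|z ->] := expg_orbit_prod t m (f x); first exact: fC.
rewrite -addn1; apply: commutator_productM (commutator_product1 _ _).
exact: (commutator_product_morph (fun y => orbit_prod t m.+1 (f y)) k x
  (orbit_prodM f t m fC) xk).
Qed.

End CommutatorProducts.

(** A product of commutators involves finitely many elements, which all come
    from one common stage. *)
Lemma commutator_product_dirlim (G : nat -> groupType)
    (phi : forall n, {multiplicative G n -> G n.+1}) k (g : dirlim phi) :
    commutator_product k g ->
  exists n (x : G n), g = dlpi phi x /\ commutator_product k x.
Proof.
elim: k g => [|k IHk] g [a [b ->]].
  by exists 0%N, 1%g; rewrite big_ord0; split=> //; apply: commutator_product0.
rewrite big_ord_recl; set h := (\prod_(i < k) _)%g.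
have [|n [x [-> xk]]] := IHk h; first by eexists _, _.
have [l [_ [y [z [_ -> ->]]]]] := dlpi_surj3 1%g (a ord0) (b ord0).
exists (l + n)%N.
rewrite -(dlpi_trans phi y (leq_addr n l)) -(dlpi_trans phi z (leq_addr n l)).
rewrite -(dlpi_trans phi x (leq_addl l n)).
set u := dltrans _ _ y; set v := dltrans _ _ z; set w := dltrans _ _ x.
exists ([~ u, v] * w)%g; split; first by rewrite gmulfM multiplicativeR.
rewrite -add1n; apply: commutator_productM (commutator_product1 _ _) _.
exact: (commutator_product_morph _ k x (dltransM phi (leq_addl l n)) xk).
Qed.

(** * Automorphisms supported on a set of generators *)

Section Support.
Context {m : nat}.
Implicit Types (A B : pred 'I_m) (f g t : aut (F m)).

(** Membership of [y] in the subgroup generated by the generators in [A],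
    expressed by its effect on homomorphisms, so that no word has to be
    inspected. *)
Definition determined_by A (y : F m) : Prop :=
  forall (K : groupType) (h k : {multiplicative F m -> K}),
    (forall i, A i -> h (fggen i) = k (fggen i)) -> h y = k y.

Definition supported_on A f : Prop :=
  forall i, if A i then determined_by A (f (fggen i))
            else f (fggen i) = fggen i.

Lemma aut_gen_ext f g :
  (forall i : 'I_m, f (fggen i) = g (fggen i)) -> f = g.
Proof. by move=> fg; apply: aut_ext; apply: freegroup_ext => i; apply: fg. Qed.

(** On a generator of [A], the automorphism [g] fixes both the generator and its
    image under [f], which is a word in generators that [g] fixes. *)
Lemma disjoint_support_commute A B f g :
    (forall i, A i -> ~~ B i) -> supported_on A f -> supported_on B g ->
  commute f g.
Proof.
move=> AB fA gB; apply: aut_gen_ext => i.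
have gfix j : ~~ B j -> g (fggen j) = fggen j.
  by have := gB j; case: (B j).
have ffix j : ~~ A j -> f (fggen j) = fggen j.
  by have := fA j; case: (A j).
rewrite !aut_mulE; case Ai: (A i).
  rewrite gfix ?AB //; have := fA i; rewrite Ai => /(_ _ g idfun) -> // j Aj.
  exact/gfix/AB.
rewrite (ffix i) ?Ai //; case Bi: (B i); last by rewrite gfix ?Bi ?ffix ?Ai.
have := gB i; rewrite Bi => /(_ _ f idfun) -> // j Bj.
by apply: ffix; apply: contraL Bj; apply: AB.
Qed.

Lemma supported_onJ A f t (s s' : 'I_m -> 'I_m) : cancel s' s ->
    (forall i, t (fggen i) = fggen (s i)) -> supported_on A f ->
  supported_on (A \o s) (f ^ t)%g.
Proof.
move=> sK tE fA i; rewrite [(f ^ t)%g]conjgE !aut_mulE tE; have := fA (s i).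
rewrite [(A \o s) i]/=.
case: (A (s i)) => [fAs|->]; last by rewrite -tE; apply: autK.
move=> K h k hk.
pose u : aut (F m) := (t^-1)%g.
have uE j : u (fggen j) = fggen (s' j) by rewrite -{1}[j]sK -tE; apply: autK.
apply: (fAs _ (h \o u) (k \o u)) => j Aj.
change (h (u (fggen j)) = k (u (fggen j))).
by rewrite uE; apply: hk; rewrite /= sK.
Qed.

End Support.

Definition initial n {m} : pred 'I_m := fun i => (i < n)%N.

(** Two homomorphisms on [F m.+1] restrict to [F m] along the inclusion, which
    reduces the claim to the homomorphisms that test [f]. *)
Lemma supported_on_stab n {m} (f : aut (F m)) : (n <= m)%N ->
  supported_on (initial n) f -> supported_on (initial n) (stab f).
Proof.
move=> le_nm fn i; rewrite /initial; case: (unliftP ord_max i) => [j|] ->.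
  rewrite -F_incl_gen stab_incl lift_max; have := fn j; rewrite /initial.
  case: (j < n)%N => [fnj|-> //] K h k hk.
  apply: (fnj _ (h \o @F_incl m) (k \o @F_incl m)) => l ln /=.
  by rewrite F_incl_gen hk // /initial lift_max.
by rewrite ltnNge le_nm stab_last.
Qed.

Lemma supported_on_dltrans {n} m (f : aut (F n)) : (n <= m)%N ->
  supported_on (initial n)
    (dltrans (fun k => [the {multiplicative _ -> _} of @stab k]) m f
      : aut (F m)).
Proof.
elim: m => [|m IHm].
  by rewrite leqn0 => /eqP n0; case=> i; subst n.
rewrite leq_eqVlt => /predU1P[e|le_nm].
  subst n; rewrite dltrans_id => i; rewrite /initial ltn_ord => K h k hk.
  by apply: freegroup_ext => j; apply: hk; apply: ltn_ord.
by rewrite dltransS //; apply: supported_on_stab (IHm _).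
Qed.

(** * Permutations of the generators *)

Section PermutationAutomorphism.
Context {m : nat} {s s' : 'I_m -> 'I_m} (sK : cancel s s') (s'K : cancel s' s).

Definition gen_map (u : 'I_m -> 'I_m) : F m -> F m :=
  fglift (fun i => fggen (u i) : F m).
HB.instance Definition _ u := Multiplicative.on (gen_map u).

Lemma gen_mapK u v : cancel u v -> cancel (gen_map u) (gen_map v).
Proof.
move=> uK; apply: (freegroup_ext (h := gen_map v \o gen_map u) (k := idfun)).
by move=> i /=; rewrite /gen_map !fglift_gen uK.
Qed.

Definition perm_aut : aut (F m) :=
  @Aut (F m) (gen_map s) (gen_map s') (@fgliftM _ _ _)
    (gen_mapK _ _ sK) (gen_mapK _ _ s'K).

Lemma perm_autX d i : (perm_aut ^+ d)%g (fggen i) = fggen (iter d s i).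
Proof.
elim: d => [|d IHd] //; rewrite expgS aut_mulE IHd /=.
by rewrite /gen_map fglift_gen.
Qed.

End PermutationAutomorphism.

(** On [n * (N + 1) + 1] generators, the cyclic shift by [n] places and its
    iterates up to the [N]-th move each of the first [n] indices to an index
    [>= n] without wrapping around. *)
Lemma shifts_commute_with_Aut n N : exists t : Aut_infty,
  forall (x y : aut (F n)) d, (d < N)%N ->
    commute (Aut_incl x) (Aut_incl y ^ (t ^+ d.+1))%g.
Proof.
pose p := (n * N.+1)%N; pose a : 'I_p.+1 := inZp n.
pose t := perm_aut (addKr a : cancel (+%R a) (+%R (- a))) (addNKr a).
exists (Aut_incl t) => x y d lt_dN.
have le_np : (n <= p.+1)%N by rewrite ltnW // ltnS leq_pmulr.
have inclE (z : aut (F n)) : Aut_incl z = Aut_incl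
    (dltrans (fun k => [the {multiplicative _ -> _} of @stab k]) p.+1 z).
  exact/esym/dlpi_trans.
rewrite (inclE x) (inclE y) -multiplicativeX -multiplicativeJ.
apply: gmulf_commute.
have tdE i : (t ^+ d.+1)%g (fggen i) = fggen (a *+ d.+1 + i).
  by rewrite perm_autX iter_addr.
apply: disjoint_support_commute (supported_on_dltrans _ x le_np)
  (supported_onJ _ _ _ _ _ (addNKr (a *+ d.+1)) tdE
    (supported_on_dltrans _ y le_np)) => i.
rewrite /initial /= Zp_mulrn /= => lt_in.
have le_ndp : (n * d.+2 <= p)%N by rewrite leq_mul2l ltnS lt_dN orbT.
rewrite -leqNgt [(n %% _)%N]modn_small; last first.
  by rewrite ltnS leq_pmulr.
rewrite modnDml modn_small; first by rewrite mulnS -addnA leq_addr.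
by rewrite ltnS (leq_trans _ le_ndp) // [(n * d.+2)%N]mulnS addnC leq_add2r ltnW.
Qed.

(** * Vanishing of the stable commutator length *)

Theorem theorem3p6 (R : realType) (g : Aut_infty) :
  commutator_subgroup g ->
  cvgn (scl_seq R g) /\ stable_commutator_length R g = 0.
Proof.
move=> /commutator_subgroupP[k /commutator_product_dirlim[n [x [gE xk]]]].
have gX N : (commutator_length (g ^+ N.+1)%g <= k.+1)%N.
  have [t tC] := shifts_commute_with_Aut n N.
  have gNk := commutator_product_expg _ t k N x tC xk.
  rewrite gE; apply: (commutator_lengthP _).2 => //.
  by apply/commutator_subgroupP; exists k.+1.
suff g0 : scl_seq R g @ \oo --> (0 : R).
  by split; [apply/cvg_ex; exists 0 | apply: cvg_lim].
rewrite -cvg_shiftS.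
have kh : (k.+1%:R * harmonic i : R) @[i --> \oo] --> (0 : R).
  rewrite -[X in _ --> X](mulr0 (k.+1%:R : R)).
  by apply: cvgMr; apply: cvg_harmonic.
apply: squeeze_cvgr kh; last exact: cvg_cst.
(* The index is shifted by one, so the bound is [k.+1 / N.+1]. *)
near=> N; rewrite /scl_seq divr_ge0 //= ler_wpM2r ?invr_ge0 // ler_nat.
exact: gX.
Unshelve. all: by end_near.
Qed.
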